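(* Let $G$ be a countably infinite group with identity $e$ and let $H,H_1,H_2\subseteq G\setminus\{e\}$ satisfy $H=H_1\cup H_2$. If $H$ is a vdC set in $G$, then $H_1$ is a vdC set in $G$ or $H_2$ is a vdC set in $G$.
   Context: A measure preserving system $(X,\mathcal{B},\mu,(T_g)_{g\in G})$ is a probability space $(X,\mathcal{B},\mu)$ together with an action $(T_g)_{g\in G}$ of $G$ on $X$ by measure preserving maps (so $T_g\circ T_h=T_{gh}$). For a countable group $G$, a set $H\subseteq G\setminus\{e\}$ is a vdC set in $G$ if for every measure preserving system $(X,\mathcal{B},\mu,(T_g)_{g\in G})$ and every (complex valued) $f\in L^\infty(\mu)$: if $\int_{X}f(T_hx)\overline{f(x)}\,d\mu(x)=0$ for all $h\in H$, then $\int_{X}f\,d\mu=0$. *)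

(* Defs.v *)
From HB Require Import structures.
From mathcomp Require Import all_boot all_order all_algebra.
From mathcomp Require Import all_classical all_reals all_analysis.
From mathcomp Require Import complex.

Set Implicit Arguments.
Unset Strict Implicit.
Unset Printing Implicit Defensive.

Import Order.TTheory GRing.Theory Num.Theory.
Import numFieldNormedType.Exports.

Local Open Scope classical_set_scope.
Local Open Scope ring_scope.
Local Open Scope complex_scope.

(* [groupType] is the structure of arbitrary, possibly infinite, groups; [G]
   carries no topology and no sigma-algebra. *)
Record measure_preserving_action (R : realType) (G : groupType)
    (d : measure_display) (X : measurableType d) (mu : probability X R)
    (T : G -> X -> X) : Prop := MeasurePreservingAction {
  action1 : T 1%g =1 id ;
  actionM : forall g h, T g \o T h =1 T (g * h)%g ;
  action_measurable : forall g, measurable_fun [set: X] (T g) ;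
  action_preserving : forall g (A : set X), measurable A ->
    mu (T g @^-1` A) = mu A }.

(* The library puts no sigma-algebra on [R[i]]. Its Borel sigma-algebra is the
   product one on R^2, so a complex function is measurable iff its real and
   imaginary parts are. *)
Definition complex_measurable (R : realType) (d : measure_display)
    (X : measurableType d) (f : X -> R[i]) : Prop :=
  measurable_fun [set: X] (fun x => complex.Re (f x)) /\
  measurable_fun [set: X] (fun x => complex.Im (f x)).

(* [normc z] is the modulus of [z] as an element of [R]. *)
Definition complex_Linfty (R : realType) (d : measure_display)
    (X : measurableType d) (mu : probability X R) (f : X -> R[i]) : Prop :=
  complex_measurable f /\
  finite_norm mu +oo%E (fun x => ComplexField.Normc.normc (f x)).

(* [Rintegral] is total; this is the Lebesgue integral whenever [f] is
   integrable, in particular for [f] in L^oo of a probability measure. *)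
Definition complex_integral (R : realType) (d : measure_display)
    (X : measurableType d) (mu : probability X R) (f : X -> R[i]) : R[i] :=
  (\int[mu]_x complex.Re (f x)) +i* (\int[mu]_x complex.Im (f x)).

(* Meant for [H] not containing the identity. *)
Definition vdC_set (R : realType) (G : groupType) (H : set G) : Prop :=
  forall (d : measure_display) (X : measurableType d) (mu : probability X R)
    (T : G -> X -> X),
  measure_preserving_action mu T ->
  forall f : X -> R[i], complex_Linfty mu f ->
  (forall h, H h ->
     complex_integral mu (fun x => f (T h x) * (f x)^*) = 0) ->
  complex_integral mu f = 0.

(* Main.v *)
Require Import Defs.
From mathcomp Require Import all_boot all_order all_algebra.
From mathcomp Require Import all_classical all_reals all_analysis.
From mathcomp Require Import complex measurable_realfun ess_sup_inf.

Set Implicit Arguments.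
Unset Strict Implicit.
Unset Printing Implicit Defensive.

Import Order.TTheory GRing.Theory Num.Theory.
Import ComplexField.Normc.

Local Open Scope classical_set_scope.
Local Open Scope ring_scope.
Local Open Scope complex_scope.

(** The complement of the vdC sets is closed under unions: if [f] and [g]
    witness that [H1] and [H2] are not vdC sets, then [f(x) g(y)], on the product
    of the two systems, witnesses that [H1 `|` H2] is not one, since its
    integral and its correlations are products of those of [f] and [g]. *)

(** * Essentially bounded complex functions *)

Section ComplexFunctions.
Context (R : realType).

Lemma ler_normRe_normc (z : R[i]) : `|complex.Re z| <= normc z.
Proof. by rewrite -lecR normc_ge_Re. Qed.

Lemma ler_normIm_normc (z : R[i]) : `|complex.Im z| <= normc z.
Proof.
have -> : complex.Im z = - complex.Re (z * 'i) by rewrite ReiNIm opprK.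
rewrite normrN (le_trans (ler_normRe_normc _))// normcM.
by rewrite [normc 'i]/= expr0n expr1n add0r sqrtr1 mulr1.
Qed.

Lemma normc_conj (z : R[i]) : normc z^* = normc z.
Proof. by case: z => a b /=; rewrite sqrrN. Qed.

Lemma ReM (z w : R[i]) : complex.Re (z * w) =
  complex.Re z * complex.Re w - complex.Im z * complex.Im w.
Proof. by case: z w => [a b] [c d]. Qed.

Lemma ImM (z w : R[i]) : complex.Im (z * w) =
  complex.Re z * complex.Im w + complex.Im z * complex.Re w.
Proof. by case: z w => [a b] [c d]. Qed.

(** An explicit almost-everywhere bound on the modulus is easier to combine and to transport than a
    finite essential supremum. *)
Lemma complex_LinftyP d (X : measurableType d) (mu : probability X R)
    (f : X -> R[i]) :
  complex_Linfty mu f <->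
  complex_measurable f /\ exists M, \forall x \ae mu, normc (f x) <= M.
Proof.
(* The norm at [+oo] is the essential supremum only when the total mass is positive; this selects
   that branch. *)
have muT_gt0 : (0 < mu [set: X])%E by rewrite probability_setT.
rewrite /complex_Linfty /finite_norm Lnorm.unlock ifT//.
rewrite [X in ess_sup _ X](_ : _ = EFin \o (fun x => normc (f x))); last first.
  apply/funext => x /=; rewrite ger0_norm//.
  by case: (f x) => u v; exact: sqrtr_ge0.
split=> -[mf]; first by move/ess_supr_bounded.
case=> M fM; split=> //; apply: le_lt_trans (ltry M).
by apply/ess_supP; apply: filterS fM => x /=; rewrite lee_fin.
Qed.

Lemma complex_LinftyM d (X : measurableType d) (mu : probability X R)
    (f g : X -> R[i]) :
  complex_Linfty mu f -> complex_Linfty mu g ->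
  complex_Linfty mu (fun x => f x * g x).
Proof.
move=> /complex_LinftyP[[mRf mIf] [M fM]] /complex_LinftyP[[mRg mIg] [N gN]].
apply/complex_LinftyP; split.
  split; [under eq_fun do rewrite ReM|under eq_fun do rewrite ImM].
    by apply: measurable_funB; exact: measurable_funM.
  by apply: measurable_funD; exact: measurable_funM.
exists (M * N); apply: filterS2 fM gN => x fM gN; rewrite normcM.
by apply: ler_pM => //; [case: (f x)|case: (g x)] => a b; exact: sqrtr_ge0.
Qed.

Lemma complex_Linfty_conj d (X : measurableType d) (mu : probability X R)
    (f : X -> R[i]) :
  complex_Linfty mu f -> complex_Linfty mu (fun x => (f x)^*).
Proof.
move=> /complex_LinftyP[[mRf mIf] [M fM]]; apply/complex_LinftyP; split; last first.
  by exists M; apply: filterS fM => x; rewrite normc_conj.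
split.
  by under eq_fun => x do
    [rewrite (_ : complex.Re (f x)^* = complex.Re (f x)); last by case: (f x)].
under eq_fun => x do
  [rewrite (_ : complex.Im (f x)^* = - complex.Im (f x)); last by case: (f x)].
exact: measurableT_comp.
Qed.

(** The null set outside which [f] is bounded pulls back along [phi] to a null set. This serves both
    for the maps of an action and for the projections of a product. *)
Lemma complex_Linfty_comp d d' (X : measurableType d) (Y : measurableType d')
    (mu : probability X R) (nu : probability Y R) (phi : X -> Y)
    (f : Y -> R[i]) :
  measurable_fun [set: X] phi ->
  (forall A, measurable A -> mu (phi @^-1` A) = nu A) ->
  complex_Linfty nu f -> complex_Linfty mu (f \o phi).
Proof.
move=> mphi pphi /complex_LinftyP[[mRf mIf] [M [N [mN N0 fM]]]].
apply/complex_LinftyP; split.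
  split; [exact: (measurableT_comp mRf mphi)|exact: (measurableT_comp mIf mphi)].
exists M, (phi @^-1` N); split; last by move=> x /fM.
- by rewrite -[X in measurable X]setTI; exact: mphi.
- by rewrite pphi.
Qed.

(** A bounded measurable function is integrable on a set of finite measure, and removing the null
    set [N] does not affect integrability. *)
Lemma integrable_ae_bounded d (X : measurableType d) (mu : probability X R)
    (a : X -> R) (M : R) :
  measurable_fun [set: X] a -> (\forall x \ae mu, `|a x| <= M) ->
  mu.-integrable [set: X] (EFin \o a).
Proof.
move=> ma [N [mN N0 aM]].
apply/(negligible_integrable mN) => //; first exact/measurable_EFinP.
apply: measurable_bounded_integrable.
- exact: measurableD.
- by rewrite (le_lt_trans (probability_le1 _ _)) ?ltry//; exact: measurableD.
- exact: measurable_funTS.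
exists M; split; first exact: num_real.
move=> K MK x [_ Nx] /=; rewrite (le_trans _ (ltW MK))//.
by apply: contrapT => axM; apply/Nx/aM.
Qed.

(** The modulus dominates the absolute values of both parts, so its bound [M] serves for each. *)
Lemma complex_Linfty_integrable d (X : measurableType d)
    (mu : probability X R) (f : X -> R[i]) : complex_Linfty mu f ->
  mu.-integrable [set: X] (EFin \o (fun x => complex.Re (f x))) /\
  mu.-integrable [set: X] (EFin \o (fun x => complex.Im (f x))).
Proof.
move=> /complex_LinftyP[[mRf mIf] [M fM]].
by split; apply: (@integrable_ae_bounded _ _ _ _ M) => //;
  apply: filterS fM => x; apply: le_trans;
  [exact: ler_normRe_normc|exact: ler_normIm_normc].
Qed.

End ComplexFunctions.

(** * Integrals and actions on a product of two probability spaces *)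

Section ProductIntegrals.
Context (R : realType) (d1 d2 : measure_display).
Context (X : measurableType d1) (Y : measurableType d2).
Context (mu : probability X R) (nu : probability Y R).

(** By Tonelli it is enough that the iterated integral of the absolute value is finite, and this
    factors into the two finite integrals of [|a|] and [|b|]. *)
Lemma integrable_tensor (a : X -> R) (b : Y -> R) :
  mu.-integrable [set: X] (EFin \o a) -> nu.-integrable [set: Y] (EFin \o b) ->
  (mu \x nu)%E.-integrable [set: X * Y] (EFin \o (fun z => a z.1 * b z.2)).
Proof.
move=> ia ib.
have ma : measurable_fun [set: X] a by exact/measurable_EFinP/(measurable_int _ ia).
have mb : measurable_fun [set: Y] b by exact/measurable_EFinP/(measurable_int _ ib).
apply/integrable12ltyP.
  apply/measurable_EFinP; apply: measurable_funM.
    exact: (measurableT_comp ma measurable_fst).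
  exact: (measurableT_comp mb measurable_snd).
have ib' : (\int[nu]_y `|(b y)%:E| < +oo)%E by case/integrableP: ib.
have ia' : (\int[mu]_x `|(a x)%:E| < +oo)%E by case/integrableP: ia.
have mabs d (Z : measurableType d) (c : Z -> R) : measurable_fun [set: Z] c ->
    measurable_fun [set: Z] (fun z => `|(c z)%:E|%E).
  by move=> mc; apply: measurableT_comp => //; exact/measurable_EFinP.
have -> : (\int[mu]_x \int[nu]_y `|(EFin \o (fun z => (a z.1 * b z.2)%R)) (x, y)| =
    \int[mu]_x (`|(a x)%:E| * \int[nu]_y `|(b y)%:E|))%E.
  apply: eq_integral => x _; rewrite -ge0_integralZl//; last exact: mabs.
  by apply: eq_integral => y _; rewrite -abseM -EFinM.
rewrite ge0_integralZr//; [|exact: mabs|exact: integral_ge0].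
have fb : (\int[nu]_y `|(b y)%:E|)%E \is a fin_num.
  by rewrite ge0_fin_numE ?integral_ge0.
have fa : (\int[mu]_x `|(a x)%:E|)%E \is a fin_num.
  by rewrite ge0_fin_numE ?integral_ge0.
by rewrite ltey_eq fin_numM.
Qed.

(** By Fubini the inner integral at [x] is [a x] times the integral of [b], a finite constant that
    leaves the outer integral. *)
Lemma Rintegral_tensor (a : X -> R) (b : Y -> R) :
  mu.-integrable [set: X] (EFin \o a) -> nu.-integrable [set: Y] (EFin \o b) ->
  \int[(mu \x nu)%E]_z (a z.1 * b z.2) = (\int[mu]_x a x) * (\int[nu]_y b y).
Proof.
move=> ia ib; rewrite -[RHS]RintegralZr// /Rintegral.
rewrite -(integral12_prod_meas1 (integrable_tensor ia ib)).
congr fine; apply: eq_integral => x _; rewrite /fubini_F /=.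
under eq_integral do rewrite EFinM.
rewrite integralZl// EFinM fineK//; exact: integrable_fin_num.
Qed.

(** Expanding real and imaginary parts gives four real products with separated variables, whose
    integrals recombine into a complex product. *)
Lemma complex_integral_tensor (f : X -> R[i]) (g : Y -> R[i]) :
  complex_Linfty mu f -> complex_Linfty nu g ->
  complex_integral (mu \x nu)%E (fun z => f z.1 * g z.2) =
  complex_integral mu f * complex_integral nu g.
Proof.
move=> /complex_Linfty_integrable[iRf iIf] /complex_Linfty_integrable[iRg iIg].
rewrite /complex_integral.
under eq_Rintegral do rewrite ReM.
under [X in _ +i* X]eq_Rintegral do rewrite ImM.
rewrite RintegralB// ?RintegralD//;
  [|exact: (integrable_tensor iRf iIg)|exact: (integrable_tensor iIf iRg)
   |exact: (integrable_tensor iRf iRg)|exact: (integrable_tensor iIf iIg)].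
by rewrite (Rintegral_tensor iRf iRg) (Rintegral_tensor iIf iIg)
  (Rintegral_tensor iRf iIg) (Rintegral_tensor iIf iRg).
Qed.

(** The other factor has total mass 1, so projections preserve measure, as [complex_Linfty_comp]
    requires. *)
Lemma product_preimage_fst (A : set X) : measurable A ->
  (mu \x nu)%E (fst @^-1` A) = mu A.
Proof.
move=> mA; have -> : fst @^-1` A = A `*` [set: Y].
  by apply/seteqP; split=> [z|z []] //=.
by rewrite product_measure1E// [X in (_ * X)%E]probability_setT mule1.
Qed.

Lemma product_preimage_snd (B : set Y) : measurable B ->
  (mu \x nu)%E (snd @^-1` B) = nu B.
Proof.
move=> mB; have -> : snd @^-1` B = [set: X] `*` B.
  by apply/seteqP; split=> [z|z []] //=.
by rewrite product_measure1E// [X in (X * _)%E]probability_setT mul1e.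
Qed.

Lemma complex_Linfty_tensor (f : X -> R[i]) (g : Y -> R[i]) :
  complex_Linfty mu f -> complex_Linfty nu g ->
  complex_Linfty (mu \x nu)%E (fun z => f z.1 * g z.2).
Proof.
move=> ff gg; apply: complex_LinftyM.
  exact: complex_Linfty_comp measurable_fst product_preimage_fst ff.
exact: complex_Linfty_comp measurable_snd product_preimage_snd gg.
Qed.

Lemma measure_preserving_action_prod (G : groupType)
    (T : G -> X -> X) (S : G -> Y -> Y) :
  measure_preserving_action mu T -> measure_preserving_action nu S ->
  measure_preserving_action (mu \x nu)%E (fun g z => (T g z.1, S g z.2)).
Proof.
move=> [T1 TM mT pT] [S1 SM mS pS].
have mTS g : measurable_fun [set: X * Y] (fun z => (T g z.1, S g z.2)).
  apply: measurable_fun_pair.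
    exact: (measurableT_comp (mT g) measurable_fst).
  exact: (measurableT_comp (mS g) measurable_snd).
split=> //.
- by move=> [x y] /=; rewrite T1 S1.
- by move=> g h [x y] /=; rewrite -TM -SM.
move=> g A mA; symmetry.
(* [m] is the image of the product measure under the map of [g]. It agrees with the product measure
   on rectangles, hence everywhere by uniqueness. *)
pose m : {measure set (X * Y) -> \bar R} :=
  measure_function_pushforward__canonical__measure_function_Measure
    (mu \x nu)%E (mTS g).
apply: (@product_measure_unique _ _ _ _ _ mu nu m) => // B C mB mC.
have mTB : measurable (T g @^-1` B) by rewrite -[X in measurable X]setTI; exact: mT.
have mSC : measurable (S g @^-1` C) by rewrite -[X in measurable X]setTI; exact: mS.
(* The preimage of a rectangle is the rectangle of the preimages. *)
transitivity (mu (T g @^-1` B) * nu (S g @^-1` C))%E.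
  exact: product_measure1E.
by congr (_ * _)%E; [exact: pT|exact: pS].
Qed.

End ProductIntegrals.

(** * The product of two counterexamples *)

Lemma not_vdC_setU (R : realType) (G : groupType) (H1 H2 : set G) :
  ~ vdC_set R H1 -> ~ vdC_set R H2 -> ~ vdC_set R (H1 `|` H2).
Proof.
move=> nH1 nH2 vH; apply: nH1 => d1 X mu T aT f ff fH.
apply: contrapT => f0; apply: nH2 => d2 Y nu S aS g gg gH.
apply: contrapT => g0.
have := vH _ _ _ _ (measure_preserving_action_prod aT aS) _
  (complex_Linfty_tensor ff gg).
rewrite complex_integral_tensor// => fg0.
(* Complex numbers have no zero divisors, so this contradicts [f0] and [g0]. *)
suff : complex_integral mu f * complex_integral nu g = 0.
  by move/eqP; rewrite mulf_eq0 => /orP[] /eqP.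
apply: fg0 => h Hh /=.
(* Regrouping separates the variables: the correlation integrand becomes that of [f] at [z.1] times
   that of [g] at [z.2]. *)
under [X in complex_integral _ X]eq_fun do rewrite rmorphM mulrACA.
have autocorr d (Z : measurableType d) (m : probability Z R) (U : G -> Z -> Z)
    (k : Z -> R[i]) : measure_preserving_action m U -> complex_Linfty m k ->
    complex_Linfty m (fun z => k (U h z) * (k z)^*).
  case=> _ _ mU pU kk; apply: complex_LinftyM; last exact: complex_Linfty_conj.
  exact: complex_Linfty_comp (mU h) (pU h) kk.
rewrite (complex_integral_tensor (autocorr _ _ _ _ _ aT ff)
  (autocorr _ _ _ _ _ aS gg)).
(* The correlation of [f] vanishes when [h] is in [H1], that of [g] when [h] is in [H2]. *)
by case: Hh => [/fH|/gH] ->; rewrite ?mul0r ?mulr0.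
Qed.

Theorem proposition6p2 (R : realType) (G : groupType)
    (G_countable : countable [set: G]) (G_infinite : infinite_set [set: G])
    (H H1 H2 : set G)
    (He : H `<=` [set~ 1%g]) (H1e : H1 `<=` [set~ 1%g])
    (H2e : H2 `<=` [set~ 1%g])
    (HU : H = H1 `|` H2) :
  vdC_set R H -> vdC_set R H1 \/ vdC_set R H2.
Proof.
rewrite HU => vH; apply: contrapT => /not_orP[nH1 nH2].
exact: not_vdC_setU nH1 nH2 vH.
Qed.
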